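(* Let $S\in\Delta^1_n$ contain a pair of symmetric arcs $(u,v)$ and $(v,u)$, and let $S'$ be the sidigraph obtained from $S$ by deleting one of these two arcs. Then $E(S')<E(S)$.
   Context: A sidigraph is a digraph (no loops, at most one arc from $u$ to $v$) with a sign $\pm1$ on each arc; its eigenvalues are those of its adjacency matrix, whose $(i,j)$ entry is the sign of the arc from $v_i$ to $v_j$ if it exists and $0$ otherwise. The energy of a sidigraph with eigenvalues $z_1,\dots,z_n$ is $E(S)=\sum_{j=1}^n|\Re z_j|$. The sign of a directed cycle is the product of its arc signs. $\Delta^1_n$ is the class of sidigraphs on $n$ vertices whose underlying digraph is bipartite and in which every directed cycle of length $\equiv 0\pmod 4$ is negative and every directed cycle of length $\equiv 2\pmod 4$ is positive. *)

(* Defs.v *)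
From HB Require Import structures.
From mathcomp Require Import all_boot all_order all_algebra all_field.
Set Implicit Arguments. Unset Strict Implicit. Unset Printing Implicit Defensive.
Import Order.TTheory GRing.Theory Num.Theory.
Local Open Scope ring_scope.

(* A sidigraph on vertex set 'I_n is given by its adjacency matrix:
   entries in {-1,0,1}, zero diagonal (no loops); A i j = sign of arc i->j,
   or 0 if there is no arc. *)
Definition is_sidigraph (n : nat) (A : 'M[int]_n) : Prop :=
  (forall i j, A i j \in [:: -1; 0; 1]) /\ (forall i, A i i = 0).

Definition sd_arc (n : nat) (A : 'M[int]_n) (i j : 'I_n) : bool := A i j != 0.

Definition bipartite_sd (n : nat) (A : 'M[int]_n) : Prop :=
  exists c : 'I_n -> bool, forall i j, sd_arc A i j -> c i != c j.

Definition cyc_pairs (n : nat) (s : seq 'I_n) : seq ('I_n * 'I_n) :=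
  zip s (rot 1 s).

Definition dcycle (n : nat) (A : 'M[int]_n) (s : seq 'I_n) : bool :=
  [&& 2 <= size s, uniq s & all (fun p => sd_arc A p.1 p.2) (cyc_pairs s)]%N.

Definition cycle_sign (n : nat) (A : 'M[int]_n) (s : seq 'I_n) : int :=
  \prod_(p <- cyc_pairs s) A p.1 p.2.

Definition Delta1 (n : nat) (A : 'M[int]_n) : Prop :=
  is_sidigraph A /\ bipartite_sd A /\
  (forall s, dcycle A s ->
     ((size s %% 4 == 0)%N -> cycle_sign A s = -1) /\
     ((size s %% 4 == 2)%N -> cycle_sign A s = 1)).

Definition sd_eigenvalues (n : nat) (A : 'M[int]_n) : seq algC :=
  sval (closed_field_poly_normal (char_poly (map_mx (fun z : int => z%:~R) A))).

Definition sd_energy (n : nat) (A : 'M[int]_n) : algC :=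
  \sum_(z <- sd_eigenvalues A) `|'Re z|.

Definition delete_arc (n : nat) (A : 'M[int]_n) (u v : 'I_n) : 'M[int]_n :=
  \matrix_(i, j) if (i == u) && (j == v) then 0 else A i j.

(* Main.v *)
Require Import Defs.
From HB Require Import structures.
From mathcomp Require Import all_boot all_order all_algebra all_fingroup all_field.
From mathcomp Require Import ring.
Import Order.TTheory GRing.Theory Num.Theory.
Local Open Scope ring_scope.

(* Expanding [det (i y - A)] over permutations, the sign conditions make every
   nonzero term equal to [i^n y^f] with [f] the number of fixed points, so on
   the imaginary axis the modulus of the characteristic polynomial strictly
   decreases when an arc lying on a 2-cycle is deleted.  Monotonicity of the
   energy is then a algebraic form of Coulson's integral formula: polynomials
   [P = (1 + a X)^N - w (1 - a X)^N] with [a > 0] and [|w| = 1] have only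
   imaginary zeros, so comparing [f] and [g] at these zeros compares the products
   of [P] over the zeros of [f] and of [g].  Letting [N] grow, then [a] tend to 0,
   turns [|P(z)|] into [max |1 +- a z| ^ N] and then into [|Re z|]. *)

(** * Sums of [|Re z|] compared through products on the imaginary axis *)

Section EnergyComparison.

Variable C : archiClosedFieldType.
Implicit Types (a c x y z w : C) (s t r : seq C) (p : {poly C}).

Lemma exists_prim_root_2exp (k : nat) : exists z, (2 ^ k).-primitive_root z.
Proof.
case: k => [|k].
  by exists 1; rewrite /primitive_root_of_unity /=; apply/forallP => -[[|//] ?] /=;
    rewrite unity_rootE expr1 eqxx.
have k0 : (0 < 2 ^ k)%N by rewrite expn_gt0.
(* The order of a [2 ^ k]-th root of [-1] divides [2 ^ k.+1] but not [2 ^ k]. *)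
pose z := (2 ^ k).-root (-1 : C); have zk : z ^+ (2 ^ k) = -1 by rewrite rootCK.
have zS : z ^+ (2 ^ k.+1) = 1 by rewrite expnSr exprM zk sqrrN expr1n.
have kS0 : (0 < 2 ^ k.+1)%N by rewrite expn_gt0.
have [m pm] := prim_order_exists kS0 zS.
move=> /(dvdn_pfactor _ _ (isT : prime 2))[j jk mE]; exists z.
move: jk; rewrite leq_eqVlt => /orP[/eqP<-|jk]; first by rewrite -mE.
have : (m %| 2 ^ k)%N by rewrite mE dvdn_exp2l.
by rewrite (prim_order_dvd pm) zk -subr_eq0 -opprD oppr_eq0 (pnatr_eq0 _ 2).
Qed.

(** A discrete maximum principle: the mean of [p] over the [L]-th roots of unity, with
    [size p <= L], is [p.[0]], so the values there cannot all be smaller in modulus. *)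
Lemma exists_unimodular_norm_ge0 p : exists2 w, `|w| = 1 & `|p.[0]| <= `|p.[w]|.
Proof.
set L := (2 ^ size p)%N; have L0 : (0 < L)%N by rewrite expn_gt0.
have sp : (size p <= L)%N by rewrite ltnW // ltn_expl.
have [z pz] : exists z, L.-primitive_root z := exists_prim_root_2exp _.
have sum0 (i : 'I_L) :
    \sum_(k < L) (z ^+ k) ^+ i = if i == 0%N :> nat then L%:R else 0.
  case: eqP => [->|/eqP i0].
    by under eq_bigr do rewrite expr0; rewrite sumr_const card_ord.
  under eq_bigr do rewrite exprAC.
  have zi1 : z ^+ i - 1 != 0.
    by rewrite subr_eq0 -(prim_order_dvd pz) gtnNdvd // lt0n.
  apply: (mulfI zi1); rewrite -subrX1 -exprM mulnC exprM (prim_expr_order pz).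
  by rewrite expr1n subrr mulr0.
have avg : \sum_(k < L) p.[z ^+ k] = L%:R * p.[0].
  under eq_bigr do rewrite (horner_coef_wide _ sp).
  rewrite exchange_big /=; under eq_bigr do rewrite -mulr_sumr sum0.
  rewrite (bigD1 (Ordinal L0)) //= big1 ?addr0 => [|i iN0].
    by rewrite horner_coef0 mulrC.
  by rewrite -val_eqE /= in iN0; rewrite (negPf iN0) mulr0.
have [/existsP[k pk]|/existsPn no] :=
    boolP [exists k : 'I_L, `|p.[0]| <= `|p.[z ^+ k]|].
  exists (z ^+ k) => //; apply/eqP.
  by rewrite -(pexpr_eq1 (n := L)) // -normrX exprAC (prim_expr_order pz) expr1n normr1.
have : `|L%:R * p.[0]| < \sum_(k < L) `|p.[0]|.
  rewrite -avg (le_lt_trans (ler_norm_sum _ _ _)) //; apply: ltr_sum => [|k _].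
    by apply/hasP; exists (Ordinal L0); rewrite ?mem_index_enum.
  by rewrite real_ltNge ?normr_real //; exact: no.
by rewrite sumr_const card_ord normrM normr_nat mulr_natl ltxx.
Qed.

(* On the unit circle [|A - w B| = |B^* - w A^*|], so each factor may be
   arranged to have the larger of its two coefficients as constant term. *)
Lemma exists_unimodular_prod_ge (T : Type) (s : seq T) (A B m : T -> C) :
  (forall i, m i = `|A i| \/ m i = `|B i|) ->
  exists2 w, `|w| = 1 &
    \prod_(i <- s) m i <= `|\prod_(i <- s) (A i - w * B i)|.
Proof.
move=> mAB.
pose c i := if m i == `|A i| then A i else (B i)^*.
pose d i := if m i == `|A i| then B i else (A i)^*.
pose p := \prod_(i <- s) ((c i)%:P - 'X * (d i)%:P).
have [w w1 pw] := exists_unimodular_norm_ge0 p.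
exists w => //; suff [<- <-] : `|p.[0]| = \prod_(i <- s) m i /\
    `|p.[w]| = `|\prod_(i <- s) (A i - w * B i)| by [].
rewrite !horner_prod !normr_prod; split; apply: eq_bigr => i _; rewrite !hornerE.
  rewrite subr0 /c; case: eqP => [->//|].
  by move=> mA; case: (mAB i) => // ->; rewrite norm_conjC.
rewrite /c /d; case: eqP => // _.
rewrite -[LHS]norm_conjC rmorphB rmorphM /= !conjCK.
by rewrite -[LHS]mul1r -w1 -normrM mulrBr mulrA -normCK w1 expr1n mul1r distrC.
Qed.

Lemma norm_sqr_1Dreal a z : a \is Num.real ->
  `|1 + a * z| ^+ 2 = 1 + a * (2 * 'Re z) + a ^+ 2 * `|z| ^+ 2.
Proof.
move=> aR; rewrite !normCK ReE [2 * _]mulrC divfK ?pnatr_eq0 //.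
rewrite rmorphD rmorphM rmorph1 /= (conj_Creal aR); ring.
Qed.

(* The larger of [|1 + a z|] and [|1 - a z|] when [a >= 0]. *)
Definition far a z : C := if 0 <= 'Re z then `|1 + a * z| else `|1 - a * z|.

Lemma far_ge0 a z : 0 <= far a z.
Proof. by rewrite /far; case: ifP. Qed.

(** The sign chosen in [far] turns the first-order coefficient in [a] into [2 |Re z|], which the
    limit [a -> 0] recovers. *)
Lemma sqr_far a z : a \is Num.real ->
  far a z ^+ 2 = 1 + a * (2 * `|'Re z|) + a ^+ 2 * `|z| ^+ 2.
Proof.
move=> aR; rewrite /far; case: ifP => Rz.
  by rewrite norm_sqr_1Dreal // (ger0_norm Rz).
rewrite -[- (a * z)]mulrN norm_sqr_1Dreal // normrN raddfN /= [`|'Re z|]ler0_norm //.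
by rewrite ltW // real_ltNge ?real0 ?Creal_Re ?Rz.
Qed.

Lemma norm_le_far a z : 0 <= a -> `|1 + a * z| <= far a z.
Proof.
move=> a0; have aR := ger0_real a0.
rewrite -(ler_pXn2r (ltn0Sn 1)) ?nnegrE ?far_ge0 // sqr_far // norm_sqr_1Dreal //.
by rewrite lerD2r lerD2l ler_wpM2l // ler_wpM2l ?ler0n // real_ler_norm ?Creal_Re.
Qed.

Lemma normB_le_far a z : 0 <= a -> `|1 - a * z| <= far a z.
Proof.
move=> a0; have := norm_le_far a (- z) a0; rewrite mulrN.
suff -> : far a (- z) = far a z by [].
apply/eqP; rewrite -(eqrXn2 (ltn0Sn 1)) ?far_ge0 // !sqr_far ?ger0_real //.
by rewrite raddfN !normrN.
Qed.

Lemma eq_norm_Re0 a z : 0 < a -> `|1 + a * z| = `|1 - a * z| -> 'Re z = 0.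
Proof.
move=> a0 /(congr1 (fun x => x ^+ 2)); rewrite -[- (a * z)]mulrN.
have aR : a \is Num.real by rewrite ger0_real ?ltW.
rewrite !norm_sqr_1Dreal // normrN raddfN /= => /addIr/addrI/(mulfI (lt0r_neq0 a0)).
have two0 : (2 : C) != 0 by rewrite pnatr_eq0.
move=> /(mulfI two0) /eqP; rewrite -subr_eq0 opprK -mulr2n mulrn_eq0 /=.
by move/eqP.
Qed.

(** Both sides are the modulus of the resultant of [p] and the monic polynomial with zeros [s]. *)
Lemma norm_prod_root_swap s p r :
  p = lead_coef p *: \prod_(z <- r) ('X - z%:P) ->
  `|\prod_(z <- s) p.[z]| =
  `|lead_coef p| ^+ size s * \prod_(y <- r) `|\prod_(z <- s) (y - z)|.
Proof.
move=> {1}->; rewrite normr_prod.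
under eq_bigr do rewrite hornerZ horner_prod normrM normr_prod.
rewrite big_split /= big_const_seq count_predT iter_mulr_1; congr (_ * _).
under [RHS]eq_bigr do rewrite normr_prod.
rewrite exchange_big /=; apply: eq_bigr => y _; apply: eq_bigr => z _.
by rewrite !hornerE distrC.
Qed.

(** If [0 < y < x], the ratio [(x / y) ^ N] grows at least linearly in [N], by the Bernoulli-type
    bound [bern], and exceeds any constant. *)
Lemma expr_bound_le x y c : 0 <= x -> 0 <= y -> 0 <= c ->
  (forall N : nat, (0 < N)%N -> x ^+ N <= c * y ^+ N) -> x <= y.
Proof.
move=> x0 y0 c0 h; rewrite real_leNgt ?ger0_real //; apply/negP => yx.
have d0 : 0 < x - y by rewrite subr_gt0.
have bern (N : nat) : y ^+ N * (x - y) *+ N <= x ^+ N * y.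
  elim: N => [|N IH]; first by rewrite mulr0n mulr_ge0 ?exprn_ge0.
  have -> : x ^+ N.+1 * y = y * x ^+ N * (x - y) + y * (x ^+ N * y).
    by rewrite exprS; ring.
  rewrite mulrS exprS -!mulrA lerD //; last by rewrite -mulrnAr ler_wpM2l.
  by rewrite ler_wpM2l // ler_wpM2r ?(ltW d0) // lerXn2r ?nnegrE // ltW.
have y_gt0 : 0 < y.
  rewrite lt_def y0 andbT; apply/eqP => yE; have := h 1%N isT.
  by rewrite !expr1 yE mulr0 => x0'; rewrite yE in yx; rewrite (lt_geF yx) in x0'.
have /archi_boundP : 0 <= c * y / (x - y) by rewrite divr_ge0 ?mulr_ge0 // ltW.
set N := Num.Def.archi_bound _ => hN.
have N0 : (0 < N)%N.
  by rewrite -(ltr0n C) (le_lt_trans _ hN) // divr_ge0 ?mulr_ge0 // ltW.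
move: hN; rewrite ltr_pdivrMr // => /(lt_geF); move/negP; apply.
rewrite mulr_natl -(ler_pM2l (exprn_gt0 N y_gt0)) mulrnAr (le_trans (bern N)) //.
by rewrite mulrA ler_wpM2r // mulrC h.
Qed.

(* The zeros of [(1 + a X)^N - w (1 - a X)^N] lie on the imaginary axis, where
   the two products are compared; up to a factor bounded independently of [N],
   its modulus at [z] is [far a z ^+ N]. *)
Lemma prod_far_le s t a :
  size s = size t -> 0 < a ->
  (forall x, x \is Num.real ->
     `|\prod_(z <- t) ('i * x - z)| <= `|\prod_(z <- s) ('i * x - z)|) ->
  \prod_(z <- t) far a z <= \prod_(z <- s) far a z.
Proof.
move=> st a0 hst; have a_ge0 := ltW a0.
(* The constant collects one factor 2 from each estimate [|p.[z]| <= 2 * far a z ^+ N]. *)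
apply: (@expr_bound_le _ _ (2 ^+ size s));
  try by [apply: prodr_ge0 => *; apply: far_ge0 | rewrite exprn_ge0 ?ler0n].
move=> N N0; rewrite -!prodrXl.
have [|w w1] := exists_unimodular_prod_ge _ t (fun z => (1 + a * z) ^+ N)
    (fun z => (1 - a * z) ^+ N) (fun z => far a z ^+ N).
  by move=> z; rewrite /far; case: ifP => _; [left|right]; rewrite normrX.
move/le_trans; apply.
pose p : {poly C} := (1 + a%:P * 'X) ^+ N - w%:P * (1 - a%:P * 'X) ^+ N.
have pE z : p.[z] = (1 + a * z) ^+ N - w * (1 - a * z) ^+ N.
  by rewrite /p !(hornerE, horner_exp).
under eq_bigr do rewrite -pE.
apply: (@le_trans _ _ `|\prod_(z <- s) p.[z]|); last first.
  rewrite normr_prod.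
  have -> : 2 ^+ size s = \prod_(z <- s) 2 :> C.
    by rewrite big_const_seq count_predT iter_mulr_1.
  rewrite -big_split; apply: ler_prod => z _; rewrite normr_ge0 pE /=.
  rewrite (le_trans (ler_normB _ _)) // normrM w1 mul1r !normrX mulr_natl mulr2n.
  by rewrite lerD // lerXn2r ?nnegrE ?far_ge0 ?norm_le_far ?normB_le_far.
have [r pr] := closed_field_poly_normal p.
(* At [a^-1] the second power vanishes, since [0 < N], and [2 ^+ N] remains. *)
have p0 : p != 0.
  apply/eqP => /(congr1 (fun q : {poly C} => q.[a^-1])); rewrite pE horner0.
  rewrite mulfV ?gt_eqF // subrr expr0n gtn_eqF // mulr0 subr0 => /eqP.
  by rewrite expf_eq0 N0 /= (pnatr_eq0 _ 2).
have r_im y : y \in r -> exists2 x, x \is Num.real & y = 'i * x.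
  move=> yr; have : root p y.
    by rewrite pr rootZ ?lead_coef_eq0 // root_prod_XsubC.
  rewrite /root pE subr_eq0 => /eqP/(congr1 Num.norm); rewrite normrM w1 mul1r !normrX.
  move=> /eqP; rewrite eqrXn2 // => /eqP /(eq_norm_Re0 _ _ a0) Ry.
  by exists ('Im y); rewrite ?Creal_Im // {1}[y]Crect Ry add0r.
(* Equal sizes give both sides the same power of the leading coefficient. *)
rewrite !(norm_prod_root_swap _ _ _ pr) st ler_wpM2l ?exprn_ge0 //.
rewrite big_seq [leRHS]big_seq; apply: ler_prod => y /r_im[x xR ->].
by rewrite normr_ge0 hst.
Qed.

Lemma prod_quadratic_ge (T : Type) (s : seq T) (f g : T -> C) a :
  (forall i, 0 <= f i) -> (forall i, 0 <= g i) -> 0 <= a ->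
  1 + a * \sum_(i <- s) f i <= \prod_(i <- s) (1 + a * f i + a ^+ 2 * g i).
Proof.
move=> f0 g0 a0; elim: s => [|i s IH]; first by rewrite !big_nil mulr0 addr0.
rewrite !big_cons.
have F0 : 0 <= \sum_(j <- s) f j by rewrite sumr_ge0.
apply: (@le_trans _ _ ((1 + a * f i + a ^+ 2 * g i) * (1 + a * \sum_(j <- s) f j))).
  rewrite -subr_ge0; set F := \sum_(j <- s) f j in F0 *.
  have -> : (1 + a * f i + a ^+ 2 * g i) * (1 + a * F) - (1 + a * (f i + F)) =
    a ^+ 2 * (f i * F + g i * (1 + a * F)) by ring.
  by rewrite ?(mulr_ge0, addr_ge0, exprn_ge0).
by rewrite ler_wpM2l // ?(mulr_ge0, addr_ge0, exprn_ge0).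
Qed.

(** For [0 <= a <= 1] the higher powers of [a] are at most [a ^+ 2], so a single constant bounds the
    remainder. *)
Lemma prod_quadratic_le (T : Type) (s : seq T) (f g : T -> C) :
  (forall i, 0 <= f i) -> (forall i, 0 <= g i) ->
  exists2 c, 0 <= c & forall a, 0 <= a -> a <= 1 ->
    \prod_(i <- s) (1 + a * f i + a ^+ 2 * g i) <=
    1 + a * \sum_(i <- s) f i + a ^+ 2 * c.
Proof.
move=> f0 g0; elim: s => [|i s [c c0 IH]].
  by exists 0 => // a _ _; rewrite !big_nil !mulr0 !addr0.
have F0 : 0 <= \sum_(j <- s) f j by rewrite sumr_ge0.
(* The sum of the coefficients of [a ^+ 2], [a ^+ 3] and [a ^+ 4] in the new factor times the
   inductive bound. *)
exists (c + f i * (\sum_(j <- s) f j + c) + g i * (1 + \sum_(j <- s) f j + c)).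
  by rewrite ?(mulr_ge0, addr_ge0).
move=> a a0 a1; rewrite !big_cons.
apply: (@le_trans _ _ ((1 + a * f i + a ^+ 2 * g i) *
   (1 + a * \sum_(j <- s) f j + a ^+ 2 * c))).
  by rewrite ler_wpM2l ?IH // ?(mulr_ge0, addr_ge0, exprn_ge0).
rewrite -subr_ge0; set F := \sum_(j <- s) f j in F0 *; set d := (X in 0 <= X).
have -> : d = a ^+ 2 * ((1 - a) * (f i * c + g i * F)
   + (1 - a) * (1 + a) * (g i * c)) by rewrite /d; ring.
have := a1; rewrite -subr_ge0; move: (1 - a) => b b0.
by rewrite ?(mulr_ge0, addr_ge0, exprn_ge0).
Qed.

Lemma le_affine_small x y c : 0 <= c ->
  (forall a, 0 < a -> a <= 1 -> x <= y + a * c) -> x \is Num.real ->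
  y \is Num.real -> x <= y.
Proof.
move=> c0 h xR yR; rewrite real_leNgt //; apply/negP => yx.
have d0 : 0 < x - y by rewrite subr_gt0.
have dc : 0 < x - y + c by rewrite ltr_wpDr.
(* This choice of [a] is at most 1 and makes [a * c] at most half of [x - y]. *)
have := h ((x - y) / (x - y + c) / 2).
have q0 : 0 < (x - y) / (x - y + c) / 2 by rewrite !divr_gt0.
have q1 : (x - y) / (x - y + c) <= 1 by rewrite ler_pdivrMr // mul1r lerDl.
move=> /(_ q0); rewrite ler_pdivrMr // mul1r (le_trans q1) ?ler1n // => /(_ isT).
rewrite -lerBlDl => /le_gtF/negP; apply.
have q2 : (x - y) / (x - y + c) * c <= x - y.
  by rewrite mulrAC ler_pdivrMr // ler_wpM2l ?(ltW d0) // lerDr ltW.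
rewrite mulrAC ltr_pdivrMr // (le_lt_trans q2) // mulr_natr mulr2n.
by rewrite ltrDl.
Qed.

(** Squaring the inequality between products of [far], expanding to first order and dividing by [a]
    leaves an error [a * c], which vanishes in the limit. *)
Lemma sum_norm_Re_le s t :
  size s = size t ->
  (forall x, x \is Num.real ->
     `|\prod_(z <- t) ('i * x - z)| <= `|\prod_(z <- s) ('i * x - z)|) ->
  \sum_(z <- t) `|'Re z| <= \sum_(z <- s) `|'Re z|.
Proof.
move=> st hst.
have f0 z : 0 <= 2 * `|'Re z| by rewrite mulr_ge0 ?ler0n.
have g0 z : 0 <= `|z| ^+ 2 by rewrite exprn_ge0.
have [c c0 hc] := prod_quadratic_le _ s _ _ f0 g0.
rewrite -(ler_pM2l (ltr0Sn C 1)) !mulr_sumr.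
apply: (@le_affine_small _ _ c c0) => [a a0 a1||]; last 2 first.
- by rewrite ger0_real // sumr_ge0.
- by rewrite ger0_real // sumr_ge0.
rewrite -(ler_pM2l a0) -(lerD2l 1) mulrDr addrA [a * (a * c)]mulrA -expr2.
apply: le_trans (hc _ (ltW a0) a1).
apply: le_trans (prod_quadratic_ge _ t _ _ _ f0 g0 (ltW a0)) _.
have aR : a \is Num.real by rewrite ger0_real ?ltW.
under eq_bigr do rewrite -sqr_far //.
under [leRHS]eq_bigr do rewrite -sqr_far //.
rewrite !prodrXl lerXn2r ?nnegrE ?prodr_ge0 //; try by move=> *; apply: far_ge0.
exact: prod_far_le.
Qed.

(** Each factor is at most [1 + |z|] if [|x| <= 1], and at most [(1 + |z|) |x|] otherwise, so one
    [K] serves both ranges. *)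
Lemma norm_prod_imag_le t : exists2 K, 1 <= K &
  forall x, x \is Num.real ->
    (`|x| <= 1 -> `|\prod_(z <- t) ('i * x - z)| <= K) /\
    (1 <= `|x| -> `|\prod_(z <- t) ('i * x - z)| <= K * `|x| ^+ size t).
Proof.
exists (\prod_(z <- t) (1 + `|z|)).
  elim: t => [|z t IH]; first by rewrite big_nil.
  by rewrite big_cons (le_trans IH) // ler_peMl ?lerDl // (le_trans ler01).
move=> x xR; rewrite normr_prod; split=> x1.
  apply: ler_prod => z _; rewrite normr_ge0 (le_trans (ler_normB _ _)) //.
  by rewrite normrM normCi mul1r lerD2r.
have -> : `|x| ^+ size t = \prod_(z <- t) `|x|.
  by rewrite big_const_seq count_predT iter_mulr_1.
rewrite -big_split; apply: ler_prod => z _.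
rewrite normr_ge0 (le_trans (ler_normB _ _)) //= normrM normCi mul1r mulrDl mul1r.
by rewrite lerD2l ler_peMr.
Qed.

(** The base 3 comes from the induction: [1 + 3 ^+ D + 3 ^+ D * a <= 3 ^+ D.+1] when [a <= 1]. *)
Lemma expr1D_le_affine a (D : nat) : 0 <= a -> a <= 1 -> (1 + a) ^+ D <= 1 + 3 ^+ D * a.
Proof.
move=> a0 a1; elim: D => [|D IH]; first by rewrite !expr0 mul1r lerDl.
rewrite exprS; apply: (@le_trans _ _ ((1 + a) * (1 + 3 ^+ D * a))).
  by rewrite ler_wpM2l // addr_ge0.
rewrite -subr_ge0; set d := (X in 0 <= X).
have -> : d = a * (3 ^+ D * (1 - a) + (3 ^+ D - 1)) by rewrite /d exprS; ring.
by rewrite mulr_ge0 // addr_ge0 ?subr_ge0 ?exprn_ege1 ?ler1n // mulr_ge0 ?exprn_ge0 ?subr_ge0.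
Qed.

(* [r] lists the zeros of [X^D + 1]. *)
Lemma exists_scaled_roots_XnD1 (D : nat) : (0 < D)%N -> (4 %| D)%N ->
  exists r, [/\ size r = D, 0 < \sum_(z <- r) `|'Re z| &
    forall a x, 0 < a -> x \is Num.real ->
      \prod_(z <- [seq a * z | z <- r]) ('i * x - z) = `|x| ^+ D + a ^+ D].
Proof.
move=> D0 D4.
have [r] := closed_field_poly_normal ('X^D + 1 : {poly C}).
have -> : 'X^D + 1 = 'X^D - (-1)%:P :> {poly C} by rewrite polyCN opprK.
rewrite (monicP _) ?monicXnsubC // scale1r => rE.
have iD x : x \is Num.real -> ('i * x) ^+ D = `|x| ^+ D.
  move=> xR; have [k ->] := dvdnP D4.
  rewrite mulnC !exprM !(exprM _ 2 2) [('i * x) ^+ 2]exprMn sqrCi mulN1r sqrrN.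
  by rewrite real_normK.
have rP z : \prod_(y <- r) (z - y) = z ^+ D + 1.
  have /(congr1 (fun q => q.[z])) := rE => /=; rewrite horner_prod.
  under eq_bigr do rewrite hornerXsubC.
  by move=> <-; rewrite !hornerE opprK.
have sr : size r = D.
  by apply/eqP; rewrite -eqSS -(size_prod_XsubC r id) -rE size_XnsubC.
exists r; split=> // [|a x a0 xR]; last first.
  rewrite big_map; have aN : a != 0 by rewrite gt_eqF.
  under eq_bigr => z _.
    have -> : 'i * x - a * z = a * ('i * (x / a) - z).
      by rewrite mulrBr [in RHS]mulrCA [a * (x / a)]mulrC divfK.
    over.
  rewrite big_split /= big_const_seq count_predT iter_mulr_1 sr rP.
  rewrite iD ?realM ?realV ?(gtr0_real a0) // normf_div expr_div_n (gtr0_norm a0).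
  by rewrite mulrDr mulr1 mulrC divfK // expf_neq0.
(* On the imaginary axis [z ^+ D + 1] is positive, so no zero lies there. *)
have Rr z : z \in r -> 0 < `|'Re z|.
  move=> zr; rewrite normr_gt0; apply/eqP => Rz.
  have : \prod_(y <- r) (z - y) = 0.
    by apply/eqP; rewrite prodf_seq_eq0; apply/hasP; exists z; rewrite ?subrr /=.
  rewrite rP [z]Crect Rz add0r iD ?Creal_Im // => /eqP.
  by rewrite gt_eqF // ltr_wpDl // exprn_ge0.
case: r sr Rr {rE rP} => [|z r] sr Rr; first by rewrite -sr in D0.
by rewrite big_cons ltr_wpDr ?Rr ?mem_head // sumr_ge0.
Qed.

(* The gain [|x| ^+ d] leaves room to multiply the two sides by
   [(x^D + 1)^2] and [(x^D + a^D) (x^D + a^-D)] for some [a > 1]; the zeros of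
   the latter have the larger sum of [|Re|] since [a + a^-1 > 2]. *)
Lemma sum_norm_Re_lt s t (d : nat) :
  size s = size t ->
  (forall x, x \is Num.real ->
     `|\prod_(z <- t) ('i * x - z)| + `|x| ^+ d <= `|\prod_(z <- s) ('i * x - z)|) ->
  \sum_(z <- t) `|'Re z| < \sum_(z <- s) `|'Re z|.
Proof.
move=> st hst; have [K K1 tK] := norm_prod_imag_le t.
(* Divisibility by 4 gives ['i ^+ D = 1]; [d <= D] serves for small [|x|], and [size t <= D] for
   large [|x|]. *)
pose D := (4 * (size t + d).+1)%N.
have [r [sr r0 rP]] := exists_scaled_roots_XnD1 D isT (dvdn_mulr _ (dvdnn 4)).
have K0 : 0 < K by rewrite (lt_le_trans ltr01).
have K3 : 1 <= K * 3 ^+ D by rewrite mulr_ege1 ?exprn_ege1 ?ler1n.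
have K30 : 0 < K * 3 ^+ D by rewrite (lt_le_trans ltr01).
(* Small enough that [K * (a ^+ D + a^-1 ^+ D - 2) <= 1]. *)
pose e := (K * 3 ^+ D)^-1; pose a := 1 + e.
have e0 : 0 < e by rewrite invr_gt0.
have e1 : e <= 1 by rewrite invf_le1.
have a1 : 1 < a by rewrite ltrDl.
have a0 : 0 < a by rewrite (lt_trans ltr01).
have aV0 : 0 < a^-1 by rewrite invr_gt0.
have eta_le : K * (a ^+ D + a^-1 ^+ D - 2) <= 1.
  have aD : a ^+ D <= 1 + 3 ^+ D * e by rewrite expr1D_le_affine // ltW.
  have aVD : a^-1 ^+ D <= 1 by rewrite exprn_ile1 ?ltW // invf_lt1.
  apply: (@le_trans _ _ (K * (3 ^+ D * e))); last by rewrite mulrA mulfV ?gt_eqF.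
  rewrite ler_pM2l // lerBlDr (le_trans (lerD aD aVD)) //.
  by rewrite -addrA addrC -addrA.
have key x : x \is Num.real ->
    `|\prod_(z <- t) ('i * x - z)| * ((`|x| ^+ D + a ^+ D) * (`|x| ^+ D + a^-1 ^+ D)) <=
    `|\prod_(z <- s) ('i * x - z)| * ((`|x| ^+ D + 1) * (`|x| ^+ D + 1)).
  move=> xR; set X := `|x|; set P := `|\prod_(z <- t) _|.
  have X0 : 0 <= X by rewrite normr_ge0.
  have G0 : 0 <= (X ^+ D + 1) * (X ^+ D + 1) by rewrite mulr_ge0 ?addr_ge0 ?exprn_ge0.
  apply: le_trans (ler_wpM2r G0 (hst x xR)); rewrite -/P -/X [leRHS]mulrDl.
  (* The multipliers differ by [eta * X ^+ D] only, an excess that the gain [X ^+ d] has to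
     cover. *)
  have -> : (X ^+ D + a ^+ D) * (X ^+ D + a^-1 ^+ D) =
      (X ^+ D + 1) * (X ^+ D + 1) + (a ^+ D + a^-1 ^+ D - 2) * X ^+ D.
    have : a ^+ D * a^-1 ^+ D = 1 by rewrite -exprMn mulfV ?gt_eqF // expr1n.
    move=> aaV; rewrite mulrDl !mulrDr aaV; ring.
  rewrite mulrDr lerD2l mulrA.
  have P0 : 0 <= P by rewrite normr_ge0.
  have [Xle Xge] := tK x xR; rewrite -/P -/X in Xle Xge.
  set eta := a ^+ D + a^-1 ^+ D - 2 in eta_le *.
  have eta0 : 0 <= eta.
    have -> : eta = a^-1 ^+ D * (a ^+ D - 1) ^+ 2.
      have : a ^+ D * a^-1 ^+ D = 1 by rewrite -exprMn mulfV ?gt_eqF // expr1n.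
      move=> aaV.
      have -> : a^-1 ^+ D * (a ^+ D - 1) ^+ 2 =
        a ^+ D * a^-1 ^+ D * a ^+ D + a^-1 ^+ D - 2 * (a ^+ D * a^-1 ^+ D) by ring.
      by rewrite aaV mul1r mulr1.
    by rewrite mulr_ge0 ?exprn_ge0 ?(ltW aV0) // subr_ge0 exprn_ege1 // ltW.
  have G1 : 1 <= (X ^+ D + 1) * (X ^+ D + 1) by rewrite mulr_ege1 ?lerDr ?exprn_ge0.
  have dD : (d <= D)%N by rewrite /D mulnC (leq_trans _ (leq_pmulr _ _)) // leqW // leq_addl.
  have tD : (size t <= D)%N by rewrite /D mulnC (leq_trans _ (leq_pmulr _ _)) // leqW // leq_addr.
  (* If [X <= 1], then [P * eta <= 1] and [X ^+ D <= X ^+ d]. Otherwise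
     [P * eta <= X ^+ size t <= X ^+ D], and [X ^+ D * X ^+ D] is below the squared multiplier. *)
  have [X1|X1] := real_leP (normr_real x) (real1 C).
    apply: (@le_trans _ _ (X ^+ d * 1)); last by rewrite ler_wpM2l ?exprn_ge0.
    rewrite mulr1; apply: (@le_trans _ _ (1 * X ^+ D)).
      by rewrite ler_wpM2r ?exprn_ge0 // (le_trans _ eta_le) // ler_wpM2r ?Xle.
    by rewrite mul1r ler_wiXn2l.
  apply: (@le_trans _ _ (X ^+ D * X ^+ D)); last first.
    apply: (@le_trans _ _ (1 * ((X ^+ D + 1) * (X ^+ D + 1)))).
      by rewrite mul1r ler_pM ?exprn_ge0 ?lerDl.
    by rewrite ler_wpM2r // exprn_ege1 // ltW.
  rewrite ler_wpM2r ?exprn_ge0 //.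
  apply: (@le_trans _ _ (1 * X ^+ size t)); last first.
    by rewrite mul1r ler_weXn2l // ltW.
  apply: (@le_trans _ _ (K * X ^+ size t * eta)).
    by rewrite ler_wpM2r // Xge // ltW.
  by rewrite mulrAC ler_wpM2r ?exprn_ge0.
pose s' := s ++ [seq 1 * z | z <- r] ++ [seq 1 * z | z <- r].
pose t' := t ++ [seq a * z | z <- r] ++ [seq a^-1 * z | z <- r].
have st' : size s' = size t' by rewrite !size_cat !size_map st.
have key' x : x \is Num.real ->
    `|\prod_(z <- t') ('i * x - z)| <= `|\prod_(z <- s') ('i * x - z)|.
  have pos c : 0 < c -> `| `|x| ^+ D + c ^+ D | = `|x| ^+ D + c ^+ D.
    by move=> c0; rewrite ger0_norm // addr_ge0 ?exprn_ge0 // ltW.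
  move=> xR; rewrite !big_cat /= !rP // !normrM !pos // expr1n.
  exact: key.
have := sum_norm_Re_le s' t' st' key'.
have scale c : 0 < c ->
    \sum_(z <- [seq c * z | z <- r]) `|'Re z| = c * \sum_(z <- r) `|'Re z|.
  move=> c0; rewrite big_map mulr_sumr; apply: eq_bigr => z _.
  by rewrite ReMl ?gtr0_real // normrM gtr0_norm.
rewrite !big_cat /= !scale //; set k := \sum_(z <- r) _ in r0 *.
rewrite -!mulrDl => h.
have : (1 + 1) * k < (a + a^-1) * k.
  rewrite ltr_pM2r // -subr_gt0.
  have -> : a + a^-1 - (1 + 1) = a^-1 * (a - 1) ^+ 2.
    by field; rewrite gt_eqF.
  by rewrite mulr_gt0 // exprn_gt0 // subr_gt0.
by move=> lt2; rewrite -(ltrD2r ((1 + 1) * k)) (lt_le_trans _ h) // ltrD2l.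
Qed.

End EnergyComparison.

(** * Signed cycles and the characteristic polynomial on the imaginary axis *)

Section SignedCycles.

Variables (n : nat) (A : 'M[int]_n).
Implicit Types (s : {perm 'I_n}) (i j x : 'I_n).

(** Fixed points stand for uncovered vertices, so these permutations are the families of
    vertex-disjoint directed cycles of the coefficient theorem. *)
Definition spanning s := [forall i, (s i != i) ==> sd_arc A i (s i)].

(** The trajectory closes up after one orbit, so rotating it by one place applies [s] to each
    entry. *)
Lemma cyc_pairs_traject s x :
  cyc_pairs (traject s x #|porbit s x|) =
  [seq (i, s i) | i <- traject s x #|porbit s x|].
Proof.
rewrite /cyc_pairs; have := iter_porbit s x.
case: #|_| => // k kx; rewrite {2}trajectS rot1_cons.
have -> : rcons (traject s (s x) k) x = [seq s i | i <- traject s x k.+1].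
  rewrite -{2}kx iterSr -trajectSr; elim: k.+1 {kx} x => //= m IH j.
  by rewrite IH.
by rewrite -{1}[traject s x _]map_id zip_map.
Qed.

Lemma prod_porbit (R : comNzRingType) (F : 'I_n -> R) s :
  \prod_i F i = \prod_(X in porbits s) \prod_(i in X) F i.
Proof.
rewrite (partition_big_imset (porbit s)) /=; apply: eq_bigr => _ /imsetP[x _ ->].
by apply: eq_bigl => i; rewrite /= eq_porbit_mem.
Qed.

Lemma porbit_fixed s x i : i \in porbit s x -> (s i == i) = (s x == x).
Proof.
case/porbitP => m ->.
by rewrite -permM -expgSr expgS permM (inj_eq perm_inj).
Qed.

(** Colours alternate along the orbit and return to the initial one at its end. *)
Lemma even_porbit s x : bipartite_sd A -> spanning s -> s x != x ->
  ~~ odd #|porbit s x|.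
Proof.
move=> [c cA] /forallP sA sx.
have sxk k : s (iter k s x) != iter k s x.
  by rewrite -iterS iterSr; elim: k => // k IH /=; rewrite (inj_eq perm_inj).
have ck k : c (iter k s x) = c x (+) odd k.
  elim: k => [|k IH] /=; first by rewrite addbF.
  have := cA _ _ (implyP (sA (iter k s x)) (sxk k)); rewrite IH.
  by case: (c (s _)); case: (c x); case: (odd k).
have := ck #|porbit s x|; rewrite iter_porbit.
by case: (c x); case: odd.
Qed.

(** The length [k] is even, so the minus signs cancel and the cycle sign remains: [-1] for [k]
    divisible by 4 and [1] for [k] congruent to 2, which is [- 'i ^+ k] in both cases. *)
Lemma prod_porbit_arcs (C : numClosedFieldType) s x :
  Delta1 A -> spanning s -> s x != x ->
  \prod_(i in porbit s x) (- (A i (s i))%:~R) = - 'i ^+ #|porbit s x| :> C.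
Proof.
move=> [_ [bip cyc]] sp sx.
have even_x := even_porbit _ _ bip sp sx.
set k := #|porbit s x| in even_x *; pose t := traject s x k.
have ut : uniq t by apply: uniq_traject_porbit.
have st : size t = k by rewrite size_traject.
have tx : t =i porbit s x by move=> i; rewrite porbit_traject.
have k0 : (0 < k)%N by rewrite lt0n card_porbit_neq0.
have k2 : (2 <= k)%N by case: (k) even_x k0 => [|[]].
have dt : dcycle A t.
  rewrite /dcycle st k2 ut cyc_pairs_traject all_map /=.
  apply/allP => i it /=; have := forallP sp i; move/implyP; apply.
  by rewrite (porbit_fixed _ x) // -tx.
have prodE : \prod_(i in porbit s x) (- (A i (s i))%:~R) = (cycle_sign A t)%:~R :> C.
  rewrite prodrN -/k -signr_odd (negPf even_x) mul1r -(eq_bigl _ _ tx) -big_uniq //.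
  by rewrite /cycle_sign cyc_pairs_traject big_map rmorph_prod.
rewrite prodE; have [c0 c2] := cyc t dt; rewrite st in c0 c2.
have : ((k %% 4 == 0) || (k %% 4 == 2))%N.
  have := even_x; rewrite {1}(divn_eq k 4) oddD oddM andbF /=.
  by have := ltn_pmod k (isT : (0 < 4)%N); case: (k %% 4)%N => [|[|[|[]]]].
have i4 : 'i ^+ 4 = 1 :> C by rewrite (exprM _ 2 2) sqrCi sqrrN expr1n.
rewrite {3}(divn_eq k 4) exprD mulnC exprM i4 expr1n mul1r.
case/orP => /eqP kE; rewrite kE /=; first by rewrite c0 ?kE // rmorphN1 expr0.
by rewrite c2 ?kE // sqrCi opprK.
Qed.

(** Orbit by orbit, a fixed point contributes ['i * y]; a cycle of even length [k] contributes its
    permutation sign [-1] times [- 'i ^+ k]. Hence all nonzero terms share the phase ['i ^+ n]. *)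
Lemma char_poly_term (C : numClosedFieldType) (y : C) s :
  Delta1 A ->
  (-1) ^+ s * \prod_i (('i * y) *+ (i == s i) - (A i (s i))%:~R) =
  if spanning s then 'i ^+ n * y ^+ #|[pred i | s i == i]| else 0.
Proof.
move=> dA; have [[_ A0] [bip _]] := dA; case: ifPn => [sp|]; last first.
  rewrite negb_forall => /existsP[i]; rewrite negb_imply negbK => /andP[si /eqP Ai].
  by rewrite (bigD1 i) //= Ai eq_sym (negPf si) subrr mul0r mulr0.
(* The parity of [s] is that of [n] plus the number of orbits; [n] is then split into orbit
   sizes. *)
have sgn : (-1) ^+ s = \prod_(X in porbits s) (-1) ^+ (odd #|X|).+1 :> C.
  rewrite /odd_perm signr_addb !signr_odd -prodr_const card_ord.
  have -> : (-1) ^+ n = \prod_(i < n) -1 :> C by rewrite prodr_const card_ord.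
  rewrite (prod_porbit _ _ s) -big_split; apply: eq_bigr => X _ /=.
  by rewrite prodr_const exprSr signr_odd.
have yE : y ^+ #|[pred i | s i == i]| = \prod_i (if s i == i then y else 1).
  by rewrite -big_mkcond prodr_const.
have iE : 'i ^+ n = \prod_(i < n) 'i :> C by rewrite prodr_const card_ord.
rewrite yE iE -big_split sgn !(prod_porbit _ _ s) -big_split /=.
apply: eq_bigr => _ /imsetP[x _ ->].
have [sx|sx] := eqVneq (s x) x.
  have card1 : #|porbit s x| == 1%N.
    have := uniq_traject_porbit s x; have := card_porbit_neq0 s x.
    by case: #|_| => [|[|k]] //= _; rewrite sx mem_head.
  have -> : porbit s x = [set x].
    by apply/setP => i; rewrite porbit_traject inE (eqP card1) /= mem_seq1.
  by rewrite cards1 !big_set1 sx eqxx A0 mulr1n subr0 sqrrN expr1n mul1r mulrC mulrC.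
have sxi i : i \in porbit s x -> s i != i by move/porbit_fixed->.
rewrite (negPf (even_porbit _ _ bip sp sx)) expr1.
rewrite (eq_bigr (fun i => - (A i (s i))%:~R)) => [|i /sxi si]; last first.
  by rewrite eq_sym (negPf si) sub0r.
rewrite [X in _ = X](eq_bigr (fun=> 'i)) => [|i /sxi si]; last by rewrite (negPf si) mulr1.
by rewrite prod_porbit_arcs // prodr_const mulN1r opprK.
Qed.

Lemma char_poly_imag (C : numClosedFieldType) (y : C) : Delta1 A ->
  (char_poly (map_mx intr A)).['i * y] =
  'i ^+ n * \sum_(s | spanning s) y ^+ #|[pred i | s i == i]|.
Proof.
move=> dA; rewrite -horner_evalE -det_map_mx /determinant mulr_sumr [RHS]big_mkcond /=.
apply: eq_bigr => s _; rewrite -char_poly_term //; congr (_ * _).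
apply: eq_bigr => i _.
by rewrite !mxE /horner_eval hornerD hornerN hornerMn hornerX hornerC.
Qed.

(** At [|x|] all terms of the sum are nonnegative, so the modulus is the sum itself; negative [x]
    reduces to this by conjugation, the matrix being real. *)
Lemma norm_char_poly_imag (C : numClosedFieldType) (x : C) :
  x \is Num.real -> Delta1 A ->
  `|(char_poly (map_mx intr A)).['i * x]| =
  \sum_(s | spanning s) `|x| ^+ #|[pred i | s i == i]|.
Proof.
move=> xR dA.
have -> : `|(char_poly (map_mx intr A)).['i * x]| =
          `|(char_poly (map_mx intr A)).['i * `|x|]|.
  have [x0|x0] := real_ge0P xR; first by [].
  rewrite -norm_conjC -horner_map map_char_poly -map_mx_comp.
  rewrite (eq_map_mx intr) => [|z /=]; last exact: rmorph_int.
  by rewrite rmorphM /= conjCi (conj_Creal xR) mulrN mulNr.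
rewrite char_poly_imag // normrM normrX normCi expr1n mul1r ger0_norm //.
by rewrite sumr_ge0 // => s _; rewrite exprn_ge0.
Qed.

End SignedCycles.

(** * Arc deletion and the final comparison *)

Lemma delete_arc_eq n (A : 'M[int]_n) u v i j :
  sd_arc (delete_arc A u v) i j -> delete_arc A u v i j = A i j.
Proof. by rewrite /sd_arc mxE; case: ifP => //; rewrite eqxx. Qed.

Lemma sd_arc_delete_arc n (A : 'M[int]_n) u v i j :
  sd_arc (delete_arc A u v) i j -> sd_arc A i j.
Proof. by move=> uv; rewrite /sd_arc -(delete_arc_eq _ _ _ _ _ _ uv). Qed.

(** Each directed cycle that survives avoids the deleted arc and keeps its sign. *)
Lemma Delta1_delete_arc n (A : 'M[int]_n) u v :
  Delta1 A -> Delta1 (delete_arc A u v).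
Proof.
move=> [[A01 A0] [[c cA] cyc]]; split; [|split].
- by split=> [i j|i]; rewrite mxE; case: ifP => //; rewrite !inE eqxx orbT.
- by exists c => i j /sd_arc_delete_arc/cA.
- move=> s ds; have -> : cycle_sign (delete_arc A u v) s = cycle_sign A s.
    rewrite /cycle_sign big_seq [RHS]big_seq; apply: eq_bigr => p ps.
    by case/and3P: ds => _ _ /allP/(_ p ps)/delete_arc_eq.
  apply: cyc; case/and3P: ds => s2 us /allP arcs; rewrite /dcycle s2 us.
  by apply/allP => p /arcs/sd_arc_delete_arc.
Qed.

Lemma prod_sd_eigenvalues n (A : 'M[int]_n) (x : algC) :
  \prod_(z <- sd_eigenvalues A) (x - z) = (char_poly (map_mx intr A)).[x].
Proof.
rewrite /sd_eigenvalues; case: closed_field_poly_normal => r /= rE.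
rewrite [in RHS]rE (monicP (char_poly_monic _)) scale1r horner_prod.
by under [RHS]eq_bigr do rewrite hornerXsubC.
Qed.

Lemma size_sd_eigenvalues n (A : 'M[int]_n) : size (sd_eigenvalues A) = n.
Proof.
rewrite /sd_eigenvalues; case: closed_field_poly_normal => r /= rE.
move: rE; rewrite (monicP (char_poly_monic _)) scale1r => rE.
by apply/eqP; rewrite -eqSS -(size_prod_XsubC r id) -rE size_char_poly.
Qed.

Theorem theorem3p5 (n : nat) (A : 'M[int]_n) (u v : 'I_n) :
  Delta1 A -> sd_arc A u v -> sd_arc A v u ->
  sd_energy (delete_arc A u v) < sd_energy A.
Proof.
move=> dA uv vu; have dA' := Delta1_delete_arc _ _ u v dA.
have uvN : u != v.
  by apply: contraTneq uv => ->; case: dA => -[_ A0] _; rewrite /sd_arc A0.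
pose f (s : {perm 'I_n}) := #|[pred i | s i == i]|.
(* The strict gain is the term of the transposition of [u] and [v], the 2-cycle that the deletion
   destroys. *)
apply: (@sum_norm_Re_lt _ _ _ (f (tperm u v))); first by rewrite !size_sd_eigenvalues.
move=> x xR; rewrite !prod_sd_eigenvalues !norm_char_poly_imag // addrC.
have spA : spanning _ A (tperm u v).
  apply/forallP => i; apply/implyP.
  by case: tpermP => [->|->|]; rewrite ?eqxx.
rewrite (bigD1 _ spA) /= lerD2l [leLHS]big_mkcond [leRHS]big_mkcond /=.
apply: ler_sum => s _; case: ifPn => [sA'|_]; last first.
  by case: ifP; rewrite ?exprn_ge0.
rewrite ifT //; apply/andP; split.
  apply/forallP => i; apply/implyP => si.
  exact: (sd_arc_delete_arc _ _ u v) (implyP (forallP sA' i) si).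
(* The transposition moves [u] along the deleted arc, so it no longer spans. *)
apply: contraTneq sA' => ->; rewrite negb_forall; apply/existsP; exists u.
by rewrite tpermL eq_sym uvN /sd_arc mxE !eqxx.
Qed.
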